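(* Let $V$ be a generalized complex vector space with structure $\mathcal J\in\operatorname{Aut}_{\mathbb R}(V\oplus V^* )$. (a) There is a unique maximal (with respect to inclusion) subspace $S\subseteq V$ such that $S$ is a generalized complex subspace of $V$ and the induced structure on $S$ is $B$-symplectic. If $V/S$ is a generalized complex quotient of $V$, then the induced structure on $V/S$ is $B$-complex. In any case, $V/S$ can be endowed with a canonical complex structure: $\operatorname{Ann}(S)\subseteq V^*$ is stable under $\mathcal J$, and the transpose of $-\mathcal J|_{\operatorname{Ann}(S)}$ is a complex structure on $V/S\cong\operatorname{Ann}(S)^*$. (b) Dually, there is a unique minimal subspace $C\subseteq V$ such that $V/C$ is a generalized complex quotient of $V$ and the induced structure on $V/C$ is $\beta$-symplectic. The subspace $C$ can be endowed with a canonical complex structure: $C$ is stable under $\mathcal J$, and $\mathcal J|_C$ is a complex structure on $C$. The subspace $C$ satisfies the graph condition with respect to (the complex generalized complex structure defined by) this complex structure. If $C$ is a generalized complex subspace of $V$, then the induced structure on $C$ is $\beta$-complex.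
   Context: All vector spaces are finite-dimensional. For a real vector space $V$, $V_{\mathbb C}$ is its complexification, with complex conjugation; $\operatorname{Ann}$ denotes the annihilator. On $V\oplus V^*$ (and its complexification) use the pairing $\langle v+f,w+g\rangle=-\tfrac12(f(w)+g(v))$. A generalized complex (GC) structure on $V$ is an $\mathbb R$-linear automorphism $\mathcal J$ of $V\oplus V^*$, orthogonal for $\langle\cdot,\cdot\rangle$, with $\mathcal J^2=-1$; equivalently a maximally isotropic complex subspace $E\subset V_{\mathbb C}\oplus V_{\mathbb C}^*$ with $E\cap\overline E=(0)$, $E$ being the $+i$-eigenspace of $\mathcal J$. Write $\mathcal J=\begin{pmatrix}\mathcal J_1&\mathcal J_2\\ \mathcal J_3&\mathcal J_4\end{pmatrix}$ with $\mathcal J_1:V\to V$, $\mathcal J_2:V^*\to V$, $\mathcal J_3:V\to V^*$, $\mathcal J_4:V^*\to V^*$. A complex structure on a real vector space is an automorphism $J$ with $J^2=-1$; it defines the complex GC structure $\begin{pmatrix}J&0\\0&-J^*\end{pmatrix}$. A nondegenerate $\omega\in\bigwedge^2V^*$ defines the symplectic GC structure $\begin{pmatrix}0&-\omega^{-1}\\ \omega&0\end{pmatrix}$. For real $B\in\bigwedge^2V^*$ (viewed as a skew map $V\to V^*$) the $B$-field transform of $\mathcal J$ is $\mathcal B\mathcal J\mathcal B^{-1}$, $\mathcal B=\begin{pmatrix}1&0\\ B&1\end{pmatrix}$; for real $\beta\in\bigwedge^2V$ (viewed as a skew map $V^*\to V$) the $\beta$-field transform is $\mathcal B'\mathcal J\mathcal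 B'^{-1}$, $\mathcal B'=\begin{pmatrix}1&\beta\\0&1\end{pmatrix}$. A structure is $B$-complex, $\beta$-complex, $B$-symplectic or $\beta$-symplectic if it is a $B$-field (resp. $\beta$-field) transform of a complex (resp. symplectic) GC structure. GC subspace: for a real subspace $W\subseteq V$ put $E_W=\{(w,f|_{W_{\mathbb C}}):(w,f)\in E\cap(W_{\mathbb C}\oplus V_{\mathbb C}^* )\}$. $W$ is a GC subspace if $E_W\cap\overline{E_W}=(0)$; then $E_W$ is the induced GC structure on $W$. GC quotient: let $\pi:V\to V/W$ be the projection and $\eta:\operatorname{Ann}(W)\to(V/W)^*$ the natural isomorphism. Put $E_{V/W}=\{(\pi(v),\eta(f)):(v,f)\in E\cap(V_{\mathbb C}\oplus\operatorname{Ann}(W_{\mathbb C}))\}$. $V/W$ is a GC quotient if $E_{V/W}\cap\overline{E_{V/W}}=(0)$; then $E_{V/W}$ is the induced GC structure on $V/W$. Graph condition: the twist of $\mathcal J$ is $\tilde{\mathcal J}=\begin{pmatrix}\mathcal J_1&-\mathcal J_2\\ -\mathcal J_3&\mathcal J_4\end{pmatrix}$. The twisted product structure on $W\oplus V$ is the direct sum $\tilde{\mathcal J}_W\oplus\mathcal J_V$ (under $(W\oplus V)\oplus(W\oplus V)^*\cong W\oplus W^*\oplus V\oplus V^*$). A subspace $U$ of a GC vector space $(X,\mathcal J)$ is generalized isotropic if $\mathcal J(U)\subseteq U\oplus\operatorname{Ann}(U)$. A subspace $W\subseteq V$ with a GC structure $\mathcal J_W$ satisfies the graph condition if $\{(w,w):w\in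 W\}\subseteq W\oplus V$ is generalized isotropic for the twisted product structure. *)

(* Defs.v *)
From HB Require Import structures.
From mathcomp Require Import all_boot all_order all_algebra.
From mathcomp Require Import classical_sets reals.
From mathcomp Require Import complex.

Set Implicit Arguments.
Unset Strict Implicit.
Unset Printing Implicit Defensive.

Import GRing.Theory.
Local Open Scope classical_set_scope.
Local Open Scope quotient_scope.
Local Open Scope ring_scope.
Local Open Scope complex_scope.

(* The dual space, with R found by unification. *)
Notation dualv V := 'Hom(V, _^o).

Section Dual.
Variable R : realType.
Implicit Types V W : vectType R.

Definition transpose_fun V W (A : 'Hom(V, W)) (f : dualv W) : dualv V :=
  (f \o A)%VF.

Lemma transpose_fun_linear V W (A : 'Hom(V, W)) : linear (transpose_fun A).
Proof. by move=> a f g; rewrite /transpose_fun comp_lfunDl comp_lfunZl. Qed.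

HB.instance Definition _ V W (A : 'Hom(V, W)) :=
  GRing.isLinear.Build R (dualv W) (dualv V) _ (transpose_fun A)
    (transpose_fun_linear A).

Definition transpose V W (A : 'Hom(V, W)) : 'Hom(dualv W, dualv V) :=
  linfun (transpose_fun A).

Lemma transposeE V W (A : 'Hom(V, W)) (f : dualv W) v :
  transpose A f v = f (A v).
Proof. by rewrite lfunE /= comp_lfunE. Qed.

Definition Ann V (W : {vspace V}) : set (dualv V) :=
  [set f | forall w, w \in W -> f w = 0].

End Dual.

(* The complexification: an element (x, y) of [cplx V] stands for x + i y. *)
Section Complexification.
Variable R : realType.

Definition cplx (V : vectType R) : Type := (V * V)%type.

Section Instances.
Variable V : vectType R.

HB.instance Definition _ := GRing.Zmodule.on (cplx V).

Definition cplx_scale (c : R[i]) (z : cplx V) : cplx V :=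
  (complex.Re c *: z.1 - complex.Im c *: z.2,
   complex.Re c *: z.2 + complex.Im c *: z.1).

Lemma cplx_scaleA a b z :
  cplx_scale a (cplx_scale b z) = cplx_scale (a * b) z.
Proof.
case: a b z => [a a'] [b b'] [x y]; rewrite /cplx_scale /= !scalerBr !scalerDr.
rewrite !scalerA !scalerBl !scalerDl !opprD; congr pair; rewrite -!addrA.
  by congr (_ + _); rewrite addrA addrC.
by congr (_ + _); rewrite addrA addrC.
Qed.

Lemma cplx_scale1 : left_id 1 cplx_scale.
Proof.
by case=> x y; rewrite /cplx_scale /= !scale1r !scale0r subr0 addr0.
Qed.

Lemma cplx_scaleDr : right_distributive cplx_scale +%R.
Proof.
move=> c [x y] [x' y']; rewrite /cplx_scale /=; congr pair => /=.
  by rewrite !scalerDr opprD addrACA.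
by rewrite !scalerDr addrACA.
Qed.

Lemma cplx_scaleDl z : {morph cplx_scale^~ z : a b / a + b}.
Proof.
case: z => x y [a a'] [b b']; rewrite /cplx_scale /=; congr pair => /=.
  by rewrite !scalerDl opprD addrACA.
by rewrite !scalerDl addrACA.
Qed.

HB.instance Definition _ := GRing.Zmodule_isLmodule.Build R[i] (cplx V)
  cplx_scaleA cplx_scale1 cplx_scaleDr cplx_scaleDl.

Definition cconj (z : cplx V) : cplx V := (z.1, - z.2).

Definition cset (A : set V) : set (cplx V) := [set z | A z.1 /\ A z.2].

End Instances.

(* The complex-linear extension of f, when f is real-linear. *)
Definition cmap (V W : vectType R) (f : V -> W) (z : cplx V) : cplx W :=
  (f z.1, f z.2).

End Complexification.

Section Quotient.
Variables (R : realType) (V : vectType R) (W : {vspace V}).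

Definition quotv : Type := Quotient.quot (pred_of_vspace W).

HB.instance Definition _ := GRing.Zmodule.on quotv.
HB.instance Definition _ := EqQuotient.on quotv.

Definition quotv_pi (v : V) : quotv := \pi_(Quotient.quot (pred_of_vspace W)) v.

Fact quotv_pi_zmod : zmod_morphism quotv_pi.
Proof. exact: raddfB. Qed.

Lemma quotv_piP x y : quotv_pi x = quotv_pi y <-> x - y \in W.
Proof.
have -> : (x - y \in W) = (x - y \in (pred_of_vspace W : {pred V})) by [].
by rewrite (Quotient.idealrBE (pred_of_vspace W)); split => /eqP.
Qed.

Lemma quotv_reprK (q : quotv) : quotv_pi (repr q) = q.
Proof. exact: reprK. Qed.

Definition quotv_scale (a : R) (q : quotv) : quotv := quotv_pi (a *: repr q).

Lemma quotv_pi_scale a v : quotv_pi (a *: v) = quotv_scale a (quotv_pi v).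
Proof.
apply/quotv_piP; rewrite -scalerBr memvZ //.
by apply/quotv_piP; rewrite quotv_reprK.
Qed.

Lemma quotv_scaleA a b q :
  quotv_scale a (quotv_scale b q) = quotv_scale (a * b) q.
Proof.
by rewrite -[q]quotv_reprK -!quotv_pi_scale scalerA.
Qed.

Lemma quotv_scale1 : left_id 1 quotv_scale.
Proof. by move=> q; rewrite -[q]quotv_reprK -quotv_pi_scale scale1r. Qed.

Lemma quotv_piD x y : quotv_pi (x + y) = quotv_pi x + quotv_pi y.
Proof. exact: raddfD. Qed.

Lemma quotv_scaleDr : right_distributive quotv_scale +%R.
Proof.
move=> a p q; rewrite -[p]quotv_reprK -[q]quotv_reprK -quotv_piD.
by rewrite -!quotv_pi_scale scalerDr quotv_piD.
Qed.

Lemma quotv_scaleDl q : {morph quotv_scale^~ q : a b / a + b}.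
Proof.
move=> a b; rewrite -[q]quotv_reprK.
by rewrite -!quotv_pi_scale scalerDl quotv_piD.
Qed.

HB.instance Definition _ := GRing.Zmodule_isLmodule.Build R quotv
  quotv_scaleA quotv_scale1 quotv_scaleDr quotv_scaleDl.

Lemma quotv_pi_linear : linear quotv_pi.
Proof. by move=> a x y; rewrite quotv_piD quotv_pi_scale. Qed.

HB.instance Definition _ :=
  GRing.isLinear.Build R V quotv _ quotv_pi quotv_pi_linear.

Import VectorInternalTheory.

(* The image of 1 - (projection onto W) is a complement of W; it is only used
   to show that the quotient is finite-dimensional. *)
Let coproj : 'End(V) := (\1 - projv W)%VF.
Let K : {vspace V} := limg coproj.
Let sec (v : V) : subvs_of K := vsproj K (coproj v).

Let sec_val v : vsval (sec v) = v - projv W v.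
Proof.
rewrite /sec vsprojK ?memv_img ?memvf //.
by rewrite /coproj add_lfunE opp_lfunE id_lfunE.
Qed.

Let sec_linear : linear sec.
Proof. by move=> a x y; rewrite /sec !linearP. Qed.

Let sec_eq x y : x - y \in W -> sec x = sec y.
Proof.
move=> xyW; apply: val_inj; rewrite /= !sec_val -{1 2}[x](subrK y) linearD /=.
by rewrite (projv_id xyW) opprD addrACA subrr add0r.
Qed.

Let coords (q : quotv) := v2r (sec (repr q)).

Let coords_linear : linear coords.
Proof.
move=> a p q; rewrite /coords.
have -> : sec (repr (a *: p + q)) = a *: sec (repr p) + sec (repr q).
  rewrite -sec_linear; apply: sec_eq; apply/quotv_piP.
  by rewrite quotv_pi_linear !quotv_reprK.
exact: linearP.
Qed.

Let coords_bij : bijective coords.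
Proof.
exists (fun r => quotv_pi (vsval (r2v r : subvs_of K))).
  move=> q; rewrite /coords v2rK sec_val.
  rewrite -[RHS]quotv_reprK; apply/quotv_piP.
  by rewrite addrAC subrr sub0r memvN memv_proj.
move=> r; rewrite /coords.
set s := r2v r.
rewrite -[RHS]r2vK -/s; congr (v2r _).
rewrite (@sec_eq _ (vsval s)); last by apply/quotv_piP; rewrite quotv_reprK.
apply: val_inj => /=; rewrite sec_val.
have /memv_imgP [u _ ->] : vsval s \in K by exact: subvsP.
rewrite /coproj add_lfunE opp_lfunE id_lfunE linearB /=.
by rewrite [X in _ - (_ - X)]projv_id ?memv_proj // subrr subr0.
Qed.

Fact quotv_vect_iso : Vector.axiom (dim (subvs_of K)) quotv.
Proof. by exists coords; [exact: coords_linear | exact: coords_bij]. Qed.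

HB.instance Definition _ := Lmodule_hasFinDim.Build R quotv quotv_vect_iso.

Definition quotv_proj : 'Hom(V, quotv) := linfun quotv_pi.

Lemma quotv_projE v : quotv_proj v = quotv_pi v.
Proof. exact: lfunE. Qed.

(* eta : Ann(W) -> (V/W)^*; the value outside Ann(W) is irrelevant. *)
Definition quotv_eta (f : dualv V) : dualv quotv :=
  linfun (fun q : quotv => f (repr q)).

Lemma quotv_etaE (f : dualv V) v :
  Ann W f -> quotv_eta f (quotv_proj v) = f v.
Proof.
move=> fW; have f_eq x y : x - y \in W -> f x = f y.
  by move=> /fW/eqP; rewrite linearB subr_eq0 => /eqP.
have f_linear : linear (fun q : quotv => f (repr q) : R^o).
  move=> a p q; rewrite -linearP; apply: f_eq; apply/quotv_piP.
  by rewrite quotv_pi_linear !quotv_reprK.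
pose fL : {linear quotv -> R^o} :=
  HB.pack (fun q : quotv => f (repr q) : R^o)
    (GRing.isLinear.Build R quotv R^o _ _ f_linear).
rewrite /quotv_eta (lfunE fL) /= quotv_projE; apply: f_eq.
by apply/quotv_piP; rewrite quotv_reprK.
Qed.

End Quotient.

Section ProductMaps.
Variables (R : realType) (U1 U2 : vectType R).

Definition inl_fun (u : U1) : U1 * U2 := (u, 0).
Definition inr_fun (u : U2) : U1 * U2 := (0, u).

Lemma inl_fun_linear : linear inl_fun.
Proof.
by move=> a u v; rewrite /inl_fun; congr pair; rewrite /= scaler0 addr0.
Qed.

Lemma inr_fun_linear : linear inr_fun.
Proof.
by move=> a u v; rewrite /inr_fun; congr pair; rewrite /= scaler0 addr0.
Qed.

HB.instance Definition _ :=
  GRing.isLinear.Build R U1 (U1 * U2)%type _ inl_fun inl_fun_linear.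
HB.instance Definition _ :=
  GRing.isLinear.Build R U2 (U1 * U2)%type _ inr_fun inr_fun_linear.

Definition inl_lfun : 'Hom(U1, (U1 * U2)%type) := linfun inl_fun.
Definition inr_lfun : 'Hom(U2, (U1 * U2)%type) := linfun inr_fun.
Definition fst_lfun : 'Hom((U1 * U2)%type, U1) := linfun fst.
Definition snd_lfun : 'Hom((U1 * U2)%type, U2) := linfun snd.

Lemma inl_lfunE u : inl_lfun u = (u, 0). Proof. exact: lfunE. Qed.
Lemma inr_lfunE u : inr_lfun u = (0, u). Proof. exact: lfunE. Qed.
Lemma fst_lfunE u : fst_lfun u = u.1. Proof. exact: lfunE. Qed.
Lemma snd_lfunE u : snd_lfun u = u.2. Proof. exact: lfunE. Qed.

End ProductMaps.

(* V + V^*.  Its complexification [cplx (gcsp V)] is identified with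
   V_C + (V_C)^*, a pair (f, g) of real functionals standing for f + i g. *)
Notation gcsp V := (V * dualv V)%type.

Section GeneralizedComplex.
Variable R : realType.
Implicit Types V : vectType R.

Definition pairing V (x y : gcsp V) : R := - 2^-1 * (x.2 y.1 + y.2 x.1).

Definition gc_structure V (J : 'End(gcsp V)) : Prop :=
  (forall x y, pairing (J x) (J y) = pairing x y) /\
  (forall x, J (J x) = - x).

Definition eigen_i V (J : 'End(gcsp V)) : set (cplx (gcsp V)) :=
  [set z | cmap J z = ('i : R[i]) *: z].

Section Block.
Variable V : vectType R.

Section Def.
Variables (J1 : 'End(V)) (J2 : 'Hom(dualv V, V)).
Variables (J3 : 'Hom(V, dualv V)) (J4 : 'End(dualv V)).

Definition block_fun (x : gcsp V) : gcsp V :=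
  (J1 x.1 + J2 x.2, J3 x.1 + J4 x.2).

Lemma block_fun_linear : linear block_fun.
Proof.
move=> a x y; rewrite /block_fun /= !linearP /=.
by congr pair; rewrite /= scalerDr addrACA.
Qed.

HB.instance Definition _ :=
  GRing.isLinear.Build R (gcsp V) (gcsp V) _ block_fun block_fun_linear.

Definition block : 'End(gcsp V) := linfun block_fun.

Lemma blockE x : block x = (J1 x.1 + J2 x.2, J3 x.1 + J4 x.2).
Proof. exact: lfunE. Qed.

End Def.

Definition block1 (J : 'End(gcsp V)) : 'End(V) :=
  (fst_lfun V (dualv V) \o J \o inl_lfun V (dualv V))%VF.
Definition block2 (J : 'End(gcsp V)) : 'Hom(dualv V, V) :=
  (fst_lfun V (dualv V) \o J \o inr_lfun V (dualv V))%VF.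
Definition block3 (J : 'End(gcsp V)) : 'Hom(V, dualv V) :=
  (snd_lfun V (dualv V) \o J \o inl_lfun V (dualv V))%VF.
Definition block4 (J : 'End(gcsp V)) : 'End(dualv V) :=
  (snd_lfun V (dualv V) \o J \o inr_lfun V (dualv V))%VF.

Lemma block_eta J : J = block (block1 J) (block2 J) (block3 J) (block4 J).
Proof.
apply/lfunP => -[v f]; rewrite blockE !comp_lfunE !fst_lfunE !snd_lfunE.
rewrite !inl_lfunE !inr_lfunE /=.
have {1}-> : (v, f) = (v, 0) + (0, f) :> gcsp V.
  by congr pair; rewrite /= ?addr0 ?add0r.
by rewrite linearD [LHS]surjective_pairing.
Qed.

Definition twist (J : 'End(gcsp V)) : 'End(gcsp V) :=
  block (block1 J) (- block2 J) (- block3 J) (block4 J).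

Definition complex_structure (J : 'End(V)) : Prop := forall v, J (J v) = - v.

Definition complex_gc (J : 'End(V)) : 'End(gcsp V) :=
  block J 0 0 (- transpose J).

(* Elements of the second exterior powers of V^* and of V, as skew maps. *)
Definition skew_2form (B : 'Hom(V, dualv V)) : Prop :=
  forall v w, B v w = - B w v.
Definition skew_bivector (b : 'Hom(dualv V, V)) : Prop :=
  forall f g : dualv V, g (b f) = - f (b g).

Definition nondegenerate_2form (w : 'Hom(V, dualv V)) : Prop :=
  forall v, (forall v', w v v' = 0) -> v = 0.

Definition symplectic_gc (w : 'Hom(V, dualv V)) : 'End(gcsp V) :=
  block 0 (- (w^-1)%VF)%R w 0.

Definition B_field (B : 'Hom(V, dualv V)) : 'End(gcsp V) := block \1 0 B \1.
Definition beta_field (b : 'Hom(dualv V, V)) : 'End(gcsp V) :=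
  block \1 b 0 \1.

Definition is_complex_gc (J : 'End(gcsp V)) : Prop :=
  exists2 J0, complex_structure J0 & J = complex_gc J0.
Definition is_symplectic_gc (J : 'End(gcsp V)) : Prop :=
  exists w, [/\ skew_2form w, nondegenerate_2form w & J = symplectic_gc w].

Definition B_transform_of (P : 'End(gcsp V) -> Prop) (J : 'End(gcsp V)) :=
  exists B J', [/\ skew_2form B, P J' &
    J = (B_field B \o J' \o (B_field B)^-1)%VF].
Definition beta_transform_of (P : 'End(gcsp V) -> Prop) (J : 'End(gcsp V)) :=
  exists b J', [/\ skew_bivector b, P J' &
    J = (beta_field b \o J' \o (beta_field b)^-1)%VF].

Definition B_complex := B_transform_of is_complex_gc.
Definition beta_complex := beta_transform_of is_complex_gc.
Definition B_symplectic := B_transform_of is_symplectic_gc.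
Definition beta_symplectic := beta_transform_of is_symplectic_gc.

End Block.

Section SubQuotient.
Variables (V : vectType R) (J : 'End(gcsp V)) (W : {vspace V}).

Definition subv_incl : 'Hom(subvs_of W, V) := linfun vsval.

(* vsproj W w is w itself, seen in W, when w is in W. *)
Definition gc_restr (x : gcsp V) : gcsp (subvs_of W) :=
  (vsproj W x.1, (x.2 \o subv_incl)%VF).

Definition eigen_sub : set (cplx (gcsp (subvs_of W))) :=
  [set cmap gc_restr z | z in
    eigen_i J `&` [set z | cset [set` W] (cmap fst z)]].

Definition gc_subspace : Prop :=
  eigen_sub `&` (@cconj R _ @` eigen_sub) = [set 0].

Definition induced_sub (JW : 'End(gcsp (subvs_of W))) : Prop :=
  gc_structure JW /\ eigen_i JW = eigen_sub.

Definition gc_proj (x : gcsp V) : gcsp (quotv W) :=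
  (quotv_proj W x.1, quotv_eta W x.2).

(* Ann(W_C) is the complexification of Ann(W). *)
Definition eigen_quot : set (cplx (gcsp (quotv W))) :=
  [set cmap gc_proj z | z in
    eigen_i J `&` [set z | cset (Ann W) (cmap snd z)]].

Definition gc_quotient : Prop :=
  eigen_quot `&` (@cconj R _ @` eigen_quot) = [set 0].

Definition induced_quot (JQ : 'End(gcsp (quotv W))) : Prop :=
  gc_structure JQ /\ eigen_i JQ = eigen_quot.

End SubQuotient.

Section DirectSum.
Variables (U1 U2 : vectType R) (J1 : 'End(gcsp U1)) (J2 : 'End(gcsp U2)).

(* A functional h on U1 + U2 corresponds to its restrictions to U1 and U2. *)
Definition gc_sum_fun (x : gcsp (U1 * U2)%type) : gcsp (U1 * U2)%type :=
  let y1 := J1 (x.1.1, (x.2 \o inl_lfun U1 U2)%VF) in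
  let y2 := J2 (x.1.2, (x.2 \o inr_lfun U1 U2)%VF) in
  ((y1.1, y2.1), (y1.2 \o fst_lfun U1 U2)%VF + (y2.2 \o snd_lfun U1 U2)%VF).

Lemma gc_sum_fun_linear : linear gc_sum_fun.
Proof.
move=> a x y; rewrite /gc_sum_fun /= !comp_lfunDl -!comp_lfunZl.
have pairP (T1 T2 : lmodType R) (s s' : T1) (t t' : T2) :
  (a *: s + s', a *: t + t') = a *: (s, t) + (s', t') by [].
rewrite !pairP !linearP /=; congr pair.
by rewrite /= !comp_lfunDl -!comp_lfunZl scalerDr addrACA.
Qed.

HB.instance Definition _ := GRing.isLinear.Build R
  (gcsp (U1 * U2)%type) (gcsp (U1 * U2)%type) _ gc_sum_fun gc_sum_fun_linear.

Definition gc_sum : 'End(gcsp (U1 * U2)%type) := linfun gc_sum_fun.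

Lemma gc_sumE x : gc_sum x = gc_sum_fun x.
Proof. exact: lfunE. Qed.

End DirectSum.

Definition gen_isotropic V (J : 'End(gcsp V)) (U : {vspace V}) : Prop :=
  forall u, u \in U -> (J (u, 0)).1 \in U /\ Ann U (J (u, 0)).2.

Section Graph.
Variables (V : vectType R) (J : 'End(gcsp V)) (W : {vspace V}).

Definition diag_fun (w : subvs_of W) : subvs_of W * V := (w, vsval w).

Lemma diag_fun_linear : linear diag_fun.
Proof. by move=> a u v; rewrite /diag_fun linearP. Qed.

HB.instance Definition _ := GRing.isLinear.Build R
  (subvs_of W) (subvs_of W * V)%type _ diag_fun diag_fun_linear.

Definition diag : {vspace (subvs_of W * V)%type} := limg (linfun diag_fun).

Lemma diagP x : reflect (exists w, x = (w, vsval w)) (x \in diag).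
Proof.
apply: (iffP memv_imgP) => [[w _ ->]|[w ->]]; exists w; rewrite ?memvf //.
  exact: lfunE.
by rewrite lfunE.
Qed.

Definition graph_condition (JW : 'End(gcsp (subvs_of W))) : Prop :=
  gen_isotropic (gc_sum (twist JW) J) diag.

End Graph.

Section Extremal.
Variables (V : vectType R) (P : {vspace V} -> Prop).

Definition maximal_vspace (S : {vspace V}) : Prop :=
  P S /\ forall T, P T -> (S <= T)%VS -> T = S.
Definition minimal_vspace (C : {vspace V}) : Prop :=
  P C /\ forall T, P T -> (T <= C)%VS -> T = C.

End Extremal.

Section Canonical.
Variables (V : vectType R) (J : 'End(gcsp V)) (W : {vspace V}).

Definition B_symplectic_subspace : Prop :=
  gc_subspace J W /\
  exists JW : 'End(gcsp (subvs_of W)), induced_sub J JW /\ B_symplectic JW.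

Definition beta_symplectic_quotient : Prop :=
  gc_quotient J W /\
  exists JQ : 'End(gcsp (quotv W)), induced_quot J JQ /\ beta_symplectic JQ.

Definition stable_subspace : Prop :=
  forall w, w \in W -> exists2 w', w' \in W & J (w, 0) = (w', 0).

Definition stable_Ann : Prop :=
  forall f, Ann W f -> exists2 f', Ann W f' & J (0, f) = (0, f').

(* JW is the restriction of J to a stable subspace W. *)
Definition is_restriction (JW : 'End(subvs_of W)) : Prop :=
  forall w, J (vsval w, 0) = (vsval (JW w), 0).

(* JQ is the transpose of -J on a stable Ann(W), under the pairing
   (f, q) |-> eta(f)(q) that identifies V/W with Ann(W)^*. *)
Definition is_neg_transpose (JQ : 'End(quotv W)) : Prop :=
  forall f q, Ann W f ->
    quotv_eta W f (JQ q) = quotv_eta W (- (J (0, f)).2) q.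

End Canonical.

End GeneralizedComplex.

(* Main.v *)
(** The subspace [S] is the image of the Poisson bivector [block2 J], and [C] is
    the kernel of the 2-form [block3 J].  A GC structure is B-symplectic iff its
    bivector is invertible and B-complex if the bivector vanishes; dually for
    beta-transforms and the 2-form.

    Restriction to a subspace and passage to a quotient are both coisotropic
    reductions: [D], one of [W + V^*] and [V + Ann W], is mapped by some
    pairing-preserving [r], with kernel [D^perp], onto the smaller double space,
    and the reduced eigenspace consists of the [r a - i r (J a)] with [a, J a] in
    [D].  If it meets its conjugate trivially, then the intersection of [D] and
    [J^-1 D] still maps onto the smaller double space, so that [J] descends.  It
    does so when [D] is [J]-stable, as are [S + V^*] and [V + Ann C].

    If [W] is B-symplectic, every [w] in [W] is the vector part of the image of
    some [(0, g)] under the induced structure; lifting [(0, g)] to some [(0, f)]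
    gives [w = block2 J f], so [W] is contained in [S].  Dually, for [c] in [C],
    the relation [J (c, 0) = (block1 J c, 0)] descends to [V/W], so the class of
    [c] lies in the kernel of the induced 2-form; hence [C] is contained in [W]
    if that form is nondegenerate. *)

Require Import Defs.
From HB Require Import structures.
From mathcomp Require Import all_boot all_order all_algebra.
From mathcomp Require Import classical_sets reals.
From mathcomp Require Import complex.

Set Implicit Arguments.
Unset Strict Implicit.
Unset Printing Implicit Defensive.

Import GRing.Theory.
Local Open Scope classical_set_scope.
Local Open Scope ring_scope.

(** * Linear algebra and separation by functionals *)

Lemma inj_lfun_surj (K : fieldType) (U V : vectType K) (h : 'Hom(U, V)) :
  dim U = dim V -> injective h -> forall v, exists u, h u = v.
Proof.
move=> dUV /lker0P/eqP h0 v.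
have : limg h == fullv.
  by rewrite eqEdim subvf limg_dim_eq ?h0 ?capv0 // !dimvf dUV /=.
move=> /eqP hV; have /memv_imgP[u _ ->] : v \in limg h by rewrite hV memvf.
by exists u.
Qed.

Lemma dim_dualv (R : realType) (V : vectType R) : dim (dualv V) = dim V.
Proof. by rewrite /dim /= muln1. Qed.

Lemma opp_fix (R : realType) (X : lmodType R) (x : X) : - x = x -> x = 0.
Proof.
move=> /eqP; rewrite eq_sym -subr_eq0 opprK -mulr2n -scaler_nat scaler_eq0.
by rewrite Num.Theory.pnatr_eq0 => /eqP.
Qed.

Lemma half_add_half (R : realType) (X : lmodType R) (x : X) :
  2^-1 *: x + 2^-1 *: x = x.
Proof. by rewrite -scalerDl -div1r -Num.Theory.splitr scale1r. Qed.

Section Functionals.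
Variable R : realType.
Implicit Types V : vectType R.

Section Coordinates.
Import VectorInternalTheory.

Lemma dualv_separates V (v : V) : (forall f : dualv V, f v = 0) -> v = 0.
Proof.
move=> v0; apply: v2r_inj; rewrite linear0; apply/rowP => i; rewrite mxE.
have cl : linear (fun u : V => v2r u 0 i : R^o).
  by move=> a x y; rewrite linearP !mxE.
pose cL : {linear V -> R^o} :=
  HB.pack (fun u : V => v2r u 0 i : R^o) (GRing.isLinear.Build R V R^o _ _ cl).
by have := v0 (linfun cL); rewrite lfunE.
Qed.

End Coordinates.

(** Any functional composed with [\1 - projv U] annihilates [U], so every functional vanishes on
    [v - projv U v]. *)
Lemma dualv_separates_vspace V (U : {vspace V}) (v : V) :
  (forall f : dualv V, Ann U f -> f v = 0) -> v \in U.
Proof.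
move=> vU; suff : v - projv U v = 0.
  by move/eqP; rewrite subr_eq0 => /eqP ->; exact: memv_proj.
apply: dualv_separates => f.
have := vU (f \o (\1 - projv U))%VF; rewrite comp_lfunE add_lfunE opp_lfunE.
rewrite id_lfunE; apply=> u uU.
by rewrite comp_lfunE add_lfunE opp_lfunE id_lfunE projv_id // subrr linear0.
Qed.

End Functionals.

(** * The eigenspace of [i] as a graph *)

Section Eigenspace.
Variables (R : realType) (X : vectType R) (J : 'End(X)).

Lemma cplx_scale_i (z : cplx X) : ('i%C : R[i]) *: z = (- z.2, z.1).
Proof.
case: z => x y; rewrite /GRing.scale /= /cplx_scale /= !scale0r !scale1r.
by rewrite sub0r add0r.
Qed.

(** For [x + i y] the eigenvalue equation reads [J x = - y] and [J y = x]; the second follows from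
    the first. Later arguments can thus stay over the reals. *)
Lemma eigen_graphE : (forall x, J (J x) = - x) ->
  [set z : cplx X | cmap J z = ('i%C : R[i]) *: z] =
  [set ((x, - J x) : cplx X) | x in setT].
Proof.
move=> J2; apply/seteqP; split=> [[x y]|_ [x _ <-]] /=; rewrite cplx_scale_i.
  by move=> [/= Jx _]; exists x => //; rewrite Jx opprK.
by rewrite /cmap /= linearN /= J2 !opprK.
Qed.

End Eigenspace.

(** * Nondegenerate symmetric bilinear forms *)

(** The model is the pairing on [V + V^*], of split signature. Linearity in the first argument
    follows from symmetry. *)
Definition inner_form (R : realType) (X : vectType R) (p : X -> X -> R) :=
  [/\ forall x y, p x y = p y x,
      forall x, linear (p x : X -> R^o)
    & forall x, (forall y, p x y = 0) -> x = 0].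

Section InnerForm.
Variables (R : realType) (X : vectType R) (p : X -> X -> R).
Hypothesis hp : inner_form p.

Lemma inner_formC x y : p x y = p y x.
Proof. by have [+ _ _] := hp. Qed.

Lemma inner_form_linear x : linear (p x : X -> R^o).
Proof. by have [_ + _] := hp. Qed.

Definition inner_form_dual (x : X) : dualv X := linfun (p x : X -> R^o).

Lemma inner_form_dualE x y : inner_form_dual x y = p x y.
Proof.
pose pL : {linear X -> R^o} := HB.pack (p x : X -> R^o)
  (GRing.isLinear.Build R X R^o _ _ (inner_form_linear x)).
exact: (lfunE pL).
Qed.

Lemma inner_form0r x : p x 0 = 0.
Proof. by rewrite -inner_form_dualE linear0. Qed.

Lemma inner_form0l x : p 0 x = 0.
Proof. by rewrite inner_formC inner_form0r. Qed.

Lemma inner_formNr x y : p x (- y) = - p x y.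
Proof. by rewrite -!inner_form_dualE linearN. Qed.

(** Nondegeneracy makes [x |-> p x] injective into a dual of the same dimension, hence onto. *)
Lemma inner_form_riesz (phi : dualv X) : exists x, forall y, phi y = p x y.
Proof.
have dl : linear inner_form_dual.
  move=> a x y; apply/lfunP => z; rewrite add_lfunE scale_lfunE.
  rewrite !inner_form_dualE ![p _ z]inner_formC; exact: inner_form_linear.
pose dL : {linear X -> dualv X} := HB.pack inner_form_dual
  (GRing.isLinear.Build R X (dualv X) _ _ dl).
have [|x y|x hx] := @inj_lfun_surj _ _ _ (linfun dL) _ _ phi.
- by rewrite dim_dualv.
- rewrite !lfunE; change (inner_form_dual x = inner_form_dual y -> x = y) => xy.
  apply/eqP; rewrite -subr_eq0; apply/eqP.
  have [_ _ +] := hp; apply=> z.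
  rewrite inner_formC -inner_form_dualE linearB /= !inner_form_dualE.
  by rewrite ![p z _]inner_formC -!inner_form_dualE xy subrr.
by exists x => y; rewrite -hx lfunE inner_form_dualE.
Qed.

(** The functionals annihilating [U] are the [p z] with [z] orthogonal to [U], and they cut out
    [U]. *)
Lemma inner_form_biorthogonal (U : {vspace X}) x :
  (forall z, (forall u, u \in U -> p z u = 0) -> p z x = 0) -> x \in U.
Proof.
move=> xU; apply: dualv_separates_vspace => phi phiU.
have [z hz] := inner_form_riesz phi.
by rewrite hz; apply: xU => u uU; rewrite -hz; exact: phiU.
Qed.

Lemma isometry_adjoint (J : 'End(X)) x y :
    (forall x y, p (J x) (J y) = p x y) -> (forall x, J (J x) = - x) ->
  p (J x) y = - p x (J y).
Proof. by move=> Jp J2; rewrite -[p x _]Jp J2 inner_formNr opprK. Qed.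

End InnerForm.

(** * Coisotropic reduction of an orthogonal complex structure *)

Section Reduction.
Variables (R : realType) (X Y : vectType R).
Variables (pX : X -> X -> R) (pY : Y -> Y -> R).
Hypotheses (hX : inner_form pX) (hY : inner_form pY).
Variable J : 'End(X).
Hypothesis Jp : forall x y, pX (J x) (J y) = pX x y.
Hypothesis J2 : forall x, J (J x) = - x.
Variables (D : {vspace X}) (r : 'Hom(X, Y)).

(** By the first two clauses the kernel of [r] on [D] is orthogonal to [D]; by the third and
    biorthogonality it is all of [D^perp]. *)
Definition coisotropic_reduction : Prop :=
  [/\ forall y, exists2 x, x \in D & r x = y,
      {in D &, forall x x', pY (r x) (r x') = pX x x'}
    & forall x, (forall k, k \in D -> r k = 0 -> pX x k = 0) -> x \in D].

Definition reduced_eigen : set (cplx Y) :=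
  [set z | exists a, [/\ a \in D, J a \in D & z = (r a, - r (J a))]].

Hypothesis hr : coisotropic_reduction.

Section Transverse.
Hypothesis hE : reduced_eigen `&` (@cconj R _ @` reduced_eigen) = [set 0].

(** The lift [J k] gives the element [r (J k) + i r k] of the reduced eigenspace; as [r k = 0], it
    equals its conjugate, so it is zero. *)
Lemma reduced_kernel_stable k : k \in D -> J k \in D -> r k = 0 -> r (J k) = 0.
Proof.
move=> kD JkD rk; suff : (r (J k), 0 : Y) = 0 :> cplx Y.
  by move=> /(congr1 fst).
suff : [set 0] ((r (J k), 0) : cplx Y) by [].
rewrite -hE; split.
  by exists (J k); rewrite J2 memvN linearN /= rk !oppr0.
exists (r (J k), 0); last by rewrite /cconj /= oppr0.
by exists (J k); rewrite J2 memvN linearN /= rk !oppr0.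
Qed.

(** As [J] squares to [-1], this is the largest [J]-stable subspace of [D]. *)
Definition stable_part : {vspace X} := (D :&: (J @^-1: D))%VS.

Lemma stable_partP a : reflect (a \in D /\ J a \in D) (a \in stable_part).
Proof. by rewrite /stable_part memv_cap -memv_preim; apply: andP. Qed.

Lemma stable_part_J a : a \in stable_part -> J a \in stable_part.
Proof.
by move=> /stable_partP[aD JaD]; apply/stable_partP; rewrite J2 memvN.
Qed.

(* The orthogonal of the stable part is [K + J K], with [K] the kernel of [r] on
   [D]; if an element [p + J q] of it lies in [D], then [J q] lies in [D], hence
   in [K] by the previous stability, so that the element itself lies in [K]. *)
Lemma stable_part_onto y : exists2 a, a \in stable_part & r a = y.
Proof.
have [rsurj rpair rD] := hr.
pose K := (D :&: lker r)%VS.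
suff /memv_imgP[a aN ->] : y \in (r @: stable_part)%VS by exists a.
(* If [y'] is orthogonal to the image of the stable part, its lift [x] in [D] is orthogonal to the
   stable part; then [x] lies in [K], and [y' = r x] is zero. *)
apply: (inner_form_biorthogonal hY) => y' y'N.
have [x xD xy'] := rsurj y'.
have xN n : n \in stable_part -> pX x n = 0.
  move=> nN; have /stable_partP[nD _] := nN.
  by rewrite -rpair // xy'; apply: y'N; exact: memv_img.
(* Orthogonality to [K] puts [z] in [D], and orthogonality to [J @: K] puts [J z] in [D]. *)
have /memv_addP[p pK [_ /memv_imgP[q qK ->] xpq]] : x \in (K + J @: K)%VS.
  apply: (inner_form_biorthogonal hX) => z zK.
  rewrite (inner_formC hX); apply: xN; apply/stable_partP; split.
    apply: rD => k kD rk; apply: zK.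
    by rewrite (subvP (addvSl _ _)) // memv_cap kD memv_ker rk eqxx.
  apply: rD => k kD rk; rewrite (isometry_adjoint hX) // zK ?oppr0 //.
  rewrite (subvP (addvSr _ _)) // memv_img //.
  by rewrite memv_cap kD memv_ker rk eqxx.
move: pK qK; rewrite !memv_cap !memv_ker => /andP[pD /eqP rp] /andP[qD /eqP rq].
have JqD : J q \in D by rewrite -[J q](addKr p) -xpq memvD ?memvN.
have rJq := reduced_kernel_stable qD JqD rq.
by rewrite -xy' xpq linearD /= rp rJq add0r (inner_form0l hY).
Qed.

(** Lift to the stable part, apply [J], and map down. Two lifts differ by an element of the stable
    part killed by [r], whose image under [J] is killed as well, so the result does not depend on
    the lift. *)
Lemma reduced_structure : exists JY : 'End(Y),
  [/\ forall x y, pY (JY x) (JY y) = pY x y,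
      forall y, JY (JY y) = - y
    & [set z : cplx Y | cmap JY z = ('i%C : R[i]) *: z] = reduced_eigen].
Proof.
have [_ rpair _] := hr.
(* [q] is onto, so [q^-1] is a right inverse; projecting its values gives a section [t] of [r]
   inside the stable part. *)
pose q := (r \o projv stable_part)%VF.
pose t := (projv stable_part \o q^-1)%VF.
have tN y : t y \in stable_part by rewrite comp_lfunE memv_proj.
have rt y : r (t y) = y.
  have yq : y \in limg q.
    have [a aN <-] := stable_part_onto y; rewrite -(projv_id aN).
    by rewrite -[r _]comp_lfunE memv_img ?memvf.
  by rewrite !comp_lfunE -[r _]comp_lfunE (limg_lfunVK yq).
pose JY := (r \o J \o t)%VF.
have JYr a : a \in stable_part -> JY (r a) = r (J a).
  move=> aN; rewrite comp_lfunE comp_lfunE; apply/eqP.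
  rewrite -subr_eq0 -!linearB /=.
  have /stable_partP[cD JcD] : t (r a) - a \in stable_part by rewrite memvB.
  by rewrite reduced_kernel_stable ?eqxx // linearB /= rt subrr.
have JYE y : JY y = r (J (t y)) by rewrite -{1}[y]rt JYr.
have tD y : t y \in D by have /stable_partP[] := tN y.
have JtD y : J (t y) \in D by have /stable_partP[] := tN y.
have JY2 y : JY (JY y) = - y.
  by rewrite (JYE y) JYr ?stable_part_J // J2 linearN /= rt.
exists JY; split=> // [y y'|].
  by rewrite !JYE rpair // Jp -rpair // !rt.
rewrite eigen_graphE //; apply/seteqP.
split=> [_ [y _ <-]|z [a [aD JaD ->]]].
  by exists (t y); rewrite rt JYE.
by exists (r a) => //; rewrite JYr //; exact/stable_partP.
Qed.

End Transverse.

(** [J] preserves [D], hence also its orthogonal, the kernel of [r] on [D]. If [r a - i r (J a)] is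
    the conjugate of [r b - i r (J b)], then [b - a] lies in that kernel, so [r (J b)] is both
    [r (J a)] and its negative. *)
Lemma stable_reduced_transverse : (forall a, a \in D -> J a \in D) ->
  reduced_eigen `&` (@cconj R _ @` reduced_eigen) = [set 0].
Proof.
have [rsurj rpair rD] := hr => DJ.
have KJ k : k \in D -> r k = 0 -> r (J k) = 0.
  move=> kD rk; have [_ _ +] := hY; apply=> y; have [x xD <-] := rsurj y.
  rewrite rpair ?DJ // (isometry_adjoint hX) // -rpair ?DJ // rk.
  by rewrite (inner_form0l hY) oppr0.
apply/seteqP; split=> [z|_ ->]; last first.
  have E0 : reduced_eigen 0.
    by exists 0; split; rewrite ?linear0 /= ?linear0 ?oppr0 ?mem0v.
  by split=> //; exists 0 => //; rewrite /cconj oppr0.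
move=> [[a [aD _ ->]] [_ [b [bD _ ->]]]] e.
have /= rba := congr1 fst e; have /= := congr1 snd e; rewrite opprK => rJba.
have rJ : r (J (b - a)) = 0.
  by apply: KJ; rewrite ?memvB // linearB /= rba subrr.
have {}rJ : r (J a) = 0.
  apply: opp_fix; rewrite -rJba; apply/eqP.
  by rewrite -subr_eq0 -!linearB /= rJ.
(* Now [J a] is in the kernel; applying [J] again kills the real part too. *)
have := KJ _ (DJ _ aD) rJ; rewrite J2 linearN rJ => /eqP; rewrite oppr_eq0.
by move=> /eqP ->; rewrite oppr0.
Qed.

Section ReducedStructure.
Variable JY : 'End(Y).
Hypothesis JYE :
  [set z : cplx Y | cmap JY z = ('i%C : R[i]) *: z] = reduced_eigen.

(** [JY] is any endomorphism with the reduced eigenspace, so this applies to every induced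
    structure. *)
Lemma reduced_structureE a : a \in D -> J a \in D -> JY (r a) = r (J a).
Proof.
move=> aD JaD; have : reduced_eigen (r a, - r (J a)) by exists a.
by rewrite -JYE /= cplx_scale_i => /(congr1 fst) /=; rewrite opprK.
Qed.

Lemma reduced_structure_lift y : (forall y, JY (JY y) = - y) ->
  exists a, [/\ a \in D, J a \in D, r a = y & JY y = r (J a)].
Proof.
move=> JY2; have : reduced_eigen (y, - JY y).
  by rewrite -JYE eigen_graphE //; exists y.
move=> [a [aD JaD e]]; have /= ya := congr1 fst e.
by exists a; split=> //; rewrite ya reduced_structureE.
Qed.

End ReducedStructure.

End Reduction.

(** * The pairing and the block identities *)

Section Pairing.
Variables (R : realType) (V : vectType R).

Lemma half_neq0 : - 2^-1 != 0 :> R.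
Proof. by rewrite oppr_eq0 invr_eq0 Num.Theory.pnatr_eq0. Qed.

Lemma pairing_inner_form : inner_form (@pairing R V).
Proof.
split=> [x y|x a y z|[v f] x0].
- by rewrite /pairing addrC.
- rewrite /pairing /= linearP add_lfunE scale_lfunE /= [in RHS]/GRing.scale /=.
  rewrite [RHS]addrC mulrCA -mulrDr; congr (_ * _).
  by rewrite mulrDr [RHS]addrC addrACA.
have h0 (a b : R) : - 2^-1 * (a + b) = 0 -> a + b = 0.
  by move/eqP; rewrite mulf_eq0 (negbTE half_neq0) => /eqP.
congr pair.
  apply: dualv_separates => g; have := h0 _ _ (x0 (0, g)).
  by rewrite /= linear0 add0r.
apply/lfunP => w; have := h0 _ _ (x0 (w, 0)).
by rewrite /= !zero_lfunE addr0.
Qed.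

End Pairing.

Section Blocks.
Variables (R : realType) (V : vectType R) (J : 'End(gcsp V)).

Lemma gcE v f : J (v, f) =
  (block1 J v + block2 J f, block3 J v + block4 J f) :> gcsp V.
Proof. by rewrite {1}[J]block_eta blockE. Qed.

Lemma gcE_vec v : J (v, 0) = (block1 J v, block3 J v).
Proof. by rewrite gcE !linear0 !addr0. Qed.

Lemma gcE_form f : J (0, f) = (block2 J f, block4 J f).
Proof. by rewrite gcE !linear0 !add0r. Qed.

Hypothesis hJ : gc_structure J.

(** [J] is skew for the pairing; on pure vectors and pure functionals this gives the symmetry of
    each block. *)
Let swap (x y : gcsp V) :
  (J x).2 y.1 + y.2 (J x).1 = - (x.2 (J y).1 + (J y).2 x.1) :> R.
Proof.
have := isometry_adjoint (@pairing_inner_form R V) x y hJ.1 hJ.2.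
by rewrite /pairing -mulrN => /(mulfI (half_neq0 _)).
Qed.

Lemma gc_block2_skew : skew_bivector (block2 J).
Proof.
move=> f g; have := swap (0, f) (0, g).
by rewrite !gcE_form /= !linear0 add0r addr0.
Qed.

Lemma gc_block3_skew : skew_2form (block3 J).
Proof.
move=> v w; have := swap (v, 0) (w, 0).
by rewrite !gcE_vec /= !zero_lfunE add0r addr0.
Qed.

Lemma gc_block1_transpose (f : dualv V) v : f (block1 J v) = - block4 J f v.
Proof.
have := swap (v, 0) (0, f).
by rewrite gcE_vec gcE_form /= !linear0 !zero_lfunE !add0r.
Qed.

Lemma gc_block_vec v :
  block1 J (block1 J v) + block2 J (block3 J v) = - v /\
  block3 J (block1 J v) + block4 J (block3 J v) = 0.
Proof.
have := hJ.2 (v, 0); rewrite gcE_vec gcE => e.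
by split; [have := congr1 fst e | have := congr1 snd e; rewrite /= oppr0].
Qed.

Lemma gc_block_form f :
  block1 J (block2 J f) + block2 J (block4 J f) = 0 /\
  block3 J (block2 J f) + block4 J (block4 J f) = - f.
Proof.
have := hJ.2 (0, f); rewrite gcE_form gcE => e.
by split; [have := congr1 fst e; rewrite /= oppr0 | have := congr1 snd e].
Qed.

End Blocks.

(** * Block criteria for [B]- and [beta]-transforms *)

Lemma lfun_conjP (K : fieldType) (X : vectType K) (B J J' : 'End(X)) :
  injective B -> J = (B \o J' \o B^-1)%VF <-> forall x, J (B x) = B (J' x).
Proof.
move=> /lker0P kB; split=> [-> x|JB].
  by rewrite !comp_lfunE lker0_lfunK.
by apply/lfunP => x; rewrite !comp_lfunE -JB lker0_lfunVK.
Qed.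

Section Transforms.
Variables (R : realType) (V : vectType R).
Implicit Types (B w : 'Hom(V, dualv V)) (b u : 'Hom(dualv V, V)).

Lemma B_fieldE B v f : B_field B (v, f) = (v, B v + f).
Proof. by rewrite blockE !id_lfunE zero_lfunE addr0. Qed.

Lemma beta_fieldE b v f : beta_field b (v, f) = (v + b f, f).
Proof. by rewrite blockE !id_lfunE zero_lfunE add0r. Qed.

Lemma B_field_conjP B (J J' : 'End(gcsp V)) :
  J = (B_field B \o J' \o (B_field B)^-1)%VF <->
  forall v f, J (v, B v + f) = B_field B (J' (v, f)).
Proof.
rewrite lfun_conjP; last first.
  move=> [v f] [v' f']; rewrite !B_fieldE => e.
  have /= vv := congr1 fst e; have /= := congr1 snd e.
  by rewrite -vv => /addrI ->.
split=> [JB v f|JB [v f]]; last by rewrite B_fieldE JB.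
by have := JB (v, f); rewrite B_fieldE.
Qed.

Lemma beta_field_conjP b (J J' : 'End(gcsp V)) :
  J = (beta_field b \o J' \o (beta_field b)^-1)%VF <->
  forall v f, J (v + b f, f) = beta_field b (J' (v, f)).
Proof.
rewrite lfun_conjP; last first.
  move=> [v f] [v' f']; rewrite !beta_fieldE => e.
  have /= ff := congr1 snd e; have /= := congr1 fst e.
  by rewrite -ff => /addIr ->.
split=> [Jb v f|Jb [v f]]; last by rewrite beta_fieldE Jb.
by have := Jb (v, f); rewrite beta_fieldE.
Qed.

Lemma nondegenerate_2form_inj w : nondegenerate_2form w -> injective w.
Proof.
move=> nw x y wxy; apply/eqP; rewrite -subr_eq0; apply/eqP; apply: nw => v.
by rewrite linearB /= wxy subrr zero_lfunE.
Qed.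

Lemma nondegenerate_2formK w : nondegenerate_2form w -> cancel w w^-1%VF.
Proof. by move=> /nondegenerate_2form_inj/lker0P/lker0_lfunK. Qed.

Lemma symplectic_gcE w v f : symplectic_gc w (v, f) = (- w^-1%VF f, w v).
Proof. by rewrite blockE !zero_lfunE opp_lfunE add0r addr0. Qed.

Lemma complex_gcE (J0 : 'End(V)) v f :
  complex_gc J0 (v, f) = (J0 v, - transpose J0 f).
Proof. by rewrite blockE !zero_lfunE opp_lfunE add0r addr0. Qed.

Lemma inverse_2form w u : cancel u w -> cancel w u ->
  nondegenerate_2form w /\ forall f, w^-1%VF f = u f.
Proof.
move=> uK wK; have nw : nondegenerate_2form w.
  move=> v wv; rewrite -[v]wK (_ : w v = 0) ?linear0 //.
  by apply/lfunP => x; rewrite wv zero_lfunE.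
by split=> // f; rewrite -{1}[f]uK nondegenerate_2formK.
Qed.

Lemma inj_bivector_inverse u : injective u ->
  exists w, cancel u w /\ cancel w u.
Proof.
move=> iu; have usurj := inj_lfun_surj (dim_dualv V) iu.
have ku : lker u == 0%VS by apply/lker0P.
exists u^-1%VF; split; first exact: lker0_lfunK.
by move=> v; have [f <-] := usurj v; rewrite lker0_lfunK.
Qed.

Lemma inj_2form_inverse w : injective w -> exists u, cancel u w /\ cancel w u.
Proof.
move=> iw; have wsurj := inj_lfun_surj (esym (dim_dualv V)) iw.
have kw : lker w == 0%VS by apply/lker0P.
exists w^-1%VF; split; last exact: lker0_lfunK.
by move=> f; have [v <-] := wsurj f; rewrite lker0_lfunK.
Qed.

Variable J : 'End(gcsp V).

(** A [B]-field leaves the block [V^* -> V] unchanged, here [- w^-1]. *)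
Lemma B_symplectic_block2_surj : B_symplectic J ->
  forall v, exists f, block2 J f = v.
Proof.
move=> [B [_ [_ [w [_ nw ->]] ]]] /B_field_conjP JB v.
exists (- w v); have := JB 0 (- w v).
rewrite linear0 add0r symplectic_gcE gcE_form B_fieldE => /(congr1 fst) /= ->.
by rewrite linearN /= opprK nondegenerate_2formK.
Qed.

(** A [beta]-field leaves the block [V -> V^*] unchanged, here [w]. *)
Lemma beta_symplectic_block3_inj : beta_symplectic J -> injective (block3 J).
Proof.
move=> [b [_ [_ [w [_ nw ->]] ]]] /beta_field_conjP Jb.
suff e v : block3 J v = w v.
  by move=> x y; rewrite !e; exact: nondegenerate_2form_inj.
have := Jb v 0; rewrite linear0 addr0 symplectic_gcE gcE_vec.
by rewrite beta_fieldE => /(congr1 snd).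
Qed.

Hypothesis hJ : gc_structure J.

Let J4E f : block4 J f = - transpose (block1 J) f.
Proof.
apply/lfunP => v.
by rewrite opp_lfunE transposeE (gc_block1_transpose hJ) opprK.
Qed.

Lemma B_symplectic_of_block2 : injective (block2 J) -> B_symplectic J.
Proof.
move=> /inj_bivector_inverse[w [uK wK]].
have sk := gc_block2_skew hJ.
have skw v v' : w v v' = - w v' v.
  by rewrite -{1}[v']wK sk wK.
have J4w v : block4 J (w v) = - w (block1 J v).
  have [+ _] := gc_block_form hJ (w v); rewrite wK => /eqP; rewrite addr_eq0.
  by move=> /eqP ->; rewrite linearN /= uK opprK.
have [nw wV] :
    nondegenerate_2form (- w) /\ forall f, (- w)^-1%VF f = (- block2 J) f.
  by apply: inverse_2form => x; rewrite !opp_lfunE linearN /= opprK ?uK ?wK.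
(* The [B]-transform of the structure of a form [s] has blocks [block2 = - s^-1] and
   [block1 = s^-1 \o B], which forces [s = - w] and this [B]. *)
exists (- (w \o block1 J))%VF, (symplectic_gc (- w)); split.
- move=> v v'; rewrite !opp_lfunE !(comp_lfunE w).
  by rewrite skw (gc_block1_transpose hJ) J4w opp_lfunE !opprK.
- by exists (- w)%R; split=> // v v'; rewrite !opp_lfunE skw.
apply/B_field_conjP => v f.
rewrite gcE symplectic_gcE B_fieldE wV !opp_lfunE opprK !(comp_lfunE w).
congr pair.
  by rewrite linearD linearN /= wK addNKr.
have J4f : - w (block1 J (block2 J f)) = block4 J f by rewrite -J4w uK.
rewrite J4f linearD linearN /= addrA [RHS]addrC; congr (_ + _).
rewrite J4w opprK; have [_] := gc_block_form hJ (w v).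
by rewrite wK !J4w linearN /= J4w opprK.
Qed.

Lemma beta_symplectic_of_block3 : injective (block3 J) -> beta_symplectic J.
Proof.
move=> i3; have [u [uK wK]] := inj_2form_inverse i3.
have sk := gc_block3_skew hJ.
have [nw wV] := inverse_2form uK wK.
have J4u f : block4 J f = - block3 J (block1 J (u f)).
  have [_ /eqP] := gc_block_vec hJ (u f).
  by rewrite uK addrC addr_eq0 => /eqP.
(* The [b]-transform of the structure of a form [s] has [block3 = s] and [block1 = b \o s], which
   forces both witnesses. *)
exists (block1 J \o u)%VF, (symplectic_gc (block3 J)); split.
- move=> f g; rewrite !(comp_lfunE (block1 J)) (gc_block1_transpose hJ) J4u.
  by rewrite opp_lfunE opprK sk uK.
- by exists (block3 J).
apply/beta_field_conjP => v f.
rewrite gcE symplectic_gcE beta_fieldE wV !(comp_lfunE (block1 J)) wK.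
congr pair; last by rewrite linearD /= J4u addrK.
have [+ _] := gc_block_vec hJ (u f); rewrite uK linearD /= -addrA => ->.
exact: addrC.
Qed.

Lemma B_complex_of_block2 : block2 J = 0 -> B_complex J.
Proof.
move=> J20.
have J11 v : block1 J (block1 J v) = - v.
  by have [+ _] := gc_block_vec hJ v; rewrite J20 zero_lfunE addr0.
have J43 v : block4 J (block3 J v) = - block3 J (block1 J v).
  by have [_ /eqP] := gc_block_vec hJ v; rewrite addrC addr_eq0 => /eqP.
(* Comparing blocks, [B] must satisfy [block3 = B \o block1 - block4 \o B]; for this choice each
   term is half of [block3]. *)
exists (- 2^-1 *: (block3 J \o block1 J))%VF, (complex_gc (block1 J)); split.
- move=> v v'; rewrite !scale_lfunE !(comp_lfunE (block3 J)).
  rewrite (gc_block3_skew hJ) (gc_block1_transpose hJ) J43 opp_lfunE !opprK.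
  by rewrite scalerN.
- by exists (block1 J).
apply/B_field_conjP => v f.
rewrite gcE complex_gcE B_fieldE J20 zero_lfunE addr0 -J4E.
congr pair; rewrite !scale_lfunE !(comp_lfunE (block3 J)) J11 linearN /=.
rewrite linearD addrA; congr (_ + _); rewrite linearZ /= J43 J11 !linearN /=.
by rewrite !scaleNr !opprK -{1}[block3 J v]half_add_half addrK.
Qed.

Lemma beta_complex_of_block3 : block3 J = 0 -> beta_complex J.
Proof.
move=> J30.
have J11 v : block1 J (block1 J v) = - v.
  by have [+ _] := gc_block_vec hJ v; rewrite J30 zero_lfunE linear0 addr0.
have J24 f : block2 J (block4 J f) = - block1 J (block2 J f).
  by have [/eqP + _] := gc_block_form hJ f; rewrite addrC addr_eq0 => /eqP.
(* Comparing blocks, [b] must satisfy [block2 = b \o block4 - block1 \o b]; for this choice each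
   term is half of [block2]. *)
exists (2^-1 *: (block1 J \o block2 J))%VF, (complex_gc (block1 J)); split.
- move=> f g; rewrite !scale_lfunE !(comp_lfunE (block1 J)) !linearZ /=.
  rewrite (gc_block1_transpose hJ) (gc_block2_skew hJ) opprK J24.
  by rewrite linearN scalerN.
- by exists (block1 J).
apply/beta_field_conjP => v f.
rewrite gcE complex_gcE beta_fieldE J30 zero_lfunE add0r -J4E.
congr pair; rewrite !scale_lfunE !(comp_lfunE (block1 J)) J24 linearN /=.
rewrite linearD -addrA; congr (_ + _); rewrite linearZ /= !J11 opprK scalerN.
by rewrite -{2}[block2 J f]half_add_half addKr.
Qed.

End Transforms.

(** * Subspaces as coisotropic reductions *)

Section SubspaceReduction.
Variables (R : realType) (V : vectType R) (J : 'End(gcsp V)) (W : {vspace V}).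

Lemma gc_restr_linear : linear (@gc_restr R V W).
Proof.
by move=> a x y; rewrite /gc_restr comp_lfunDl -comp_lfunZl linearP.
Qed.

HB.instance Definition _ := GRing.isLinear.Build R (gcsp V)
  (gcsp (subvs_of W)) _ (@gc_restr R V W) gc_restr_linear.

Definition sub_domain : {vspace gcsp V} := (fst_lfun V (dualv V) @^-1: W)%VS.
Definition sub_map : 'Hom(gcsp V, gcsp (subvs_of W)) :=
  linfun (@gc_restr R V W).

Lemma sub_domainE x : (x \in sub_domain) = (x.1 \in W).
Proof. by rewrite -memv_preim fst_lfunE. Qed.

Lemma sub_mapE x : sub_map x = @gc_restr R V W x.
Proof. exact: lfunE. Qed.

Lemma subv_inclE u : subv_incl W u = vsval u.
Proof. exact: lfunE. Qed.

Lemma dual_restr_onto (g : dualv (subvs_of W)) :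
  exists f : dualv V, (f \o subv_incl W)%VF = g.
Proof.
exists (g \o linfun (vsproj W))%VF; apply/lfunP => u.
by rewrite !comp_lfunE subv_inclE lfunE /= vsvalK.
Qed.

(** For the last clause: the [(0, g)] with [g] in [Ann W] lie in the kernel, and orthogonality to
    them forces the vector part into [W]. *)
Lemma sub_coisotropic :
  coisotropic_reduction (@pairing R _) (@pairing R _) sub_domain sub_map.
Proof.
split.
- move=> [u g]; have [f <-] := dual_restr_onto g.
  exists (vsval u, f); rewrite ?sub_domainE ?subvsP //.
  by rewrite sub_mapE /gc_restr /= vsvalK.
- move=> [v f] [v' f']; rewrite !sub_domainE /= => vW v'W.
  by rewrite !sub_mapE /gc_restr /pairing /= !comp_lfunE !subv_inclE !vsprojK.
move=> [v f] xK; rewrite sub_domainE; apply: dualv_separates_vspace => g gW.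
have /eqP : pairing (v, f) (0, g) = 0.
  apply: xK; rewrite ?sub_domainE ?mem0v // sub_mapE /gc_restr linear0.
  congr pair.
  by apply/lfunP => u; rewrite comp_lfunE subv_inclE gW ?subvsP // zero_lfunE.
rewrite /pairing /= linear0 add0r mulf_eq0 (negbTE (half_neq0 R)).
by move/eqP.
Qed.

Hypothesis hJ : gc_structure J.

Lemma eigen_subE : @eigen_sub R V J W = reduced_eigen J sub_domain sub_map.
Proof.
rewrite /eigen_sub /eigen_i eigen_graphE; last exact: hJ.2.
apply/seteqP; split=> [_ [_ [[a _ <-] [/= aW JaW]] <-]|_ [a [aD JaD ->]]].
  exists a; rewrite !sub_domainE aW -memvN; split=> //.
  by rewrite /cmap /= -!sub_mapE linearN.
exists (a, - J a).
  split; first by exists a.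
  by move: aD JaD; rewrite !sub_domainE /cset /= memvN.
by rewrite /cmap /= -!sub_mapE linearN.
Qed.

Lemma gc_subspace_induced :
  gc_subspace J W -> exists JW, @induced_sub R V J W JW.
Proof.
rewrite /gc_subspace eigen_subE => hE.
have [JW [JWp JW2 eW]] := reduced_structure (@pairing_inner_form R _)
  (@pairing_inner_form R _) hJ.1 hJ.2 sub_coisotropic hE.
by exists JW; split; [split | rewrite eigen_subE -eW].
Qed.

Lemma induced_subE (JW : 'End(gcsp (subvs_of W))) v f : induced_sub J JW ->
  v \in W -> (J (v, f)).1 \in W -> JW (sub_map (v, f)) = sub_map (J (v, f)).
Proof.
rewrite /induced_sub eigen_subE => -[_ eW] vW JvW.
by apply: (reduced_structureE eW); rewrite sub_domainE.
Qed.

Lemma induced_sub_lift (JW : 'End(gcsp (subvs_of W))) y : induced_sub J JW ->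
  exists a, [/\ a.1 \in W, (J a).1 \in W, sub_map a = y & JW y = sub_map (J a)].
Proof.
rewrite /induced_sub eigen_subE => -[[_ JW2] eW].
have [a [+ + ay Jy]] := reduced_structure_lift eW y JW2.
by rewrite !sub_domainE => aW JaW; exists a.
Qed.

Lemma stable_gc_subspace :
  (forall v f, v \in W -> (J (v, f)).1 \in W) -> gc_subspace J W.
Proof.
move=> WJ; rewrite /gc_subspace eigen_subE.
apply: (stable_reduced_transverse (@pairing_inner_form R _)
  (@pairing_inner_form R _) hJ.1 hJ.2 sub_coisotropic) => -[v f].
by rewrite !sub_domainE; apply: WJ.
Qed.

End SubspaceReduction.

(** * Quotients as coisotropic reductions *)

Section QuotientReduction.
Variables (R : realType) (V : vectType R) (J : 'End(gcsp V)) (W : {vspace V}).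

(** [V + Ann W], with [Ann W] encoded as the kernel of restriction to [W]. *)
Definition quot_domain : {vspace gcsp V} :=
  (snd_lfun V (dualv V) @^-1: lker (transpose (subv_incl W)))%VS.
Definition quot_section : 'Hom(quotv W, V) := (quotv_proj W)^-1%VF.

Lemma quot_sectionK : cancel quot_section (quotv_proj W).
Proof.
move=> q; apply: limg_lfunVK; rewrite -[q]quotv_reprK -quotv_projE.
by rewrite memv_img ?memvf.
Qed.

Lemma quotv_proj_eq0 v : (quotv_proj W v == 0) = (v \in W).
Proof.
have <- : quotv_pi W 0 = 0 by exact: linear0.
rewrite quotv_projE -[v in RHS]subr0.
by apply/eqP/idP => [/quotv_piP//|vW]; apply/quotv_piP.
Qed.

(** Pullback along a linear section is linear on all functionals, whereas [quotv_eta] is meaningful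
    only on [Ann W], where the two agree. *)
Definition quot_fun (x : gcsp V) : gcsp (quotv W) :=
  (quotv_proj W x.1, (x.2 \o quot_section)%VF).

Lemma quot_fun_linear : linear quot_fun.
Proof.
by move=> a x y; rewrite /quot_fun comp_lfunDl -comp_lfunZl linearP.
Qed.

HB.instance Definition _ := GRing.isLinear.Build R (gcsp V)
  (gcsp (quotv W)) _ quot_fun quot_fun_linear.

Definition quot_map : 'Hom(gcsp V, gcsp (quotv W)) := linfun quot_fun.

Lemma quot_domainP x : reflect (Ann W x.2) (x \in quot_domain).
Proof.
rewrite -memv_preim snd_lfunE memv_ker.
apply: (iffP eqP) => [x0 w wW|xW].
  have /lfunP/(_ (vsproj W w)) := x0.
  by rewrite transposeE subv_inclE vsprojK // zero_lfunE.
by apply/lfunP => u; rewrite transposeE subv_inclE zero_lfunE xW ?subvsP.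
Qed.

Lemma quot_mapE v f : Ann W f ->
  quot_map (v, f) = (quotv_proj W v, quotv_eta W f).
Proof.
move=> fW; rewrite lfunE /= /quot_fun /=; congr pair; apply/lfunP => q.
by rewrite comp_lfunE -[q]quot_sectionK quotv_etaE // quot_sectionK.
Qed.

Lemma Ann_pullback (g : dualv (quotv W)) : Ann W (g \o quotv_proj W)%VF.
Proof.
move=> w; rewrite -quotv_proj_eq0 => /eqP wW.
by rewrite comp_lfunE wW linear0.
Qed.

Lemma quot_map_pullback v (g : dualv (quotv W)) :
  quot_map (v, (g \o quotv_proj W)%VF) = (quotv_proj W v, g).
Proof.
rewrite quot_mapE; last exact: Ann_pullback.
congr pair; apply/lfunP => p; rewrite -[p]quot_sectionK.
by rewrite quotv_etaE ?comp_lfunE //; exact: Ann_pullback.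
Qed.

Lemma quot_map_vec v : quot_map (v, 0) = (quotv_proj W v, 0).
Proof.
rewrite -(quot_map_pullback v 0); congr (quot_map (_, _)).
by rewrite comp_lfun0l.
Qed.

(** For the last clause: the [(w, 0)] with [w] in [W] lie in the kernel, and orthogonality to them
    forces the functional part into [Ann W]. *)
Lemma quot_coisotropic :
  coisotropic_reduction (@pairing R _) (@pairing R _) quot_domain quot_map.
Proof.
split.
- move=> [q g]; exists (quot_section q, (g \o quotv_proj W)%VF).
    by apply/quot_domainP; exact: Ann_pullback.
  by rewrite quot_map_pullback quot_sectionK.
- move=> [v f] [v' f'] /quot_domainP fW /quot_domainP fW'.
  by rewrite !quot_mapE // /pairing /= !quotv_etaE.
move=> [v f] xK; apply/quot_domainP => w wW /=.
have W0 : Ann W (0 : dualv V) by move=> ? _; rewrite zero_lfunE.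
have /eqP : pairing (v, f) (w, 0) = 0.
  apply: xK; first exact/quot_domainP.
  rewrite quot_map_vec; congr pair.
  by apply/eqP; rewrite quotv_proj_eq0.
rewrite /pairing /= zero_lfunE addr0 mulf_eq0 (negbTE (half_neq0 R)).
by move/eqP.
Qed.

Hypothesis hJ : gc_structure J.

Lemma eigen_quotE : @eigen_quot R V J W = reduced_eigen J quot_domain quot_map.
Proof.
have projE x : x \in quot_domain -> gc_proj W x = quot_map x.
  by move=> /quot_domainP xW; rewrite [x in RHS]surjective_pairing quot_mapE.
rewrite /eigen_quot /eigen_i eigen_graphE; last exact: hJ.2.
apply/seteqP; split=> [_ [_ [[a _ <-] [/= aW JaW]] <-]|_ [a [aD JaD ->]]].
  have aD : a \in quot_domain by exact/quot_domainP.
  have JaD : - J a \in quot_domain by exact/quot_domainP.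
  exists a; split=> //; first by rewrite -memvN.
  by rewrite /cmap /= !projE // linearN.
exists (a, - J a).
  split; first by exists a.
  by split; apply/quot_domainP; rewrite ?memvN.
by rewrite /cmap /= !projE ?memvN // linearN.
Qed.

Lemma gc_quotient_induced :
  gc_quotient J W -> exists JQ, @induced_quot R V J W JQ.
Proof.
rewrite /gc_quotient eigen_quotE => hE.
have [JQ [JQp JQ2 eQ]] := reduced_structure (@pairing_inner_form R _)
  (@pairing_inner_form R _) hJ.1 hJ.2 quot_coisotropic hE.
by exists JQ; split; [split | rewrite eigen_quotE -eQ].
Qed.

Lemma induced_quotE (JQ : 'End(gcsp (quotv W))) x : induced_quot J JQ ->
  Ann W x.2 -> Ann W (J x).2 -> JQ (quot_map x) = quot_map (J x).
Proof.
rewrite /induced_quot eigen_quotE => -[_ eQ] xW JxW.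
by apply: (reduced_structureE eQ); exact/quot_domainP.
Qed.

Lemma stable_gc_quotient :
  (forall x, Ann W x.2 -> Ann W (J x).2) -> gc_quotient J W.
Proof.
move=> WJ; rewrite /gc_quotient eigen_quotE.
apply: (stable_reduced_transverse (@pairing_inner_form R _)
  (@pairing_inner_form R _) hJ.1 hJ.2 quot_coisotropic) => x.
by move=> /quot_domainP/WJ/quot_domainP.
Qed.

End QuotientReduction.

(** * The maximal [B]-symplectic subspace [S] *)

Section SymplecticLeaf.
Variables (R : realType) (V : vectType R) (J : 'End(gcsp V)).
Hypothesis hJ : gc_structure J.

Definition symplectic_leaf : {vspace V} := limg (block2 J).
Local Notation S := symplectic_leaf.

(** The kernel of a skew map is the annihilator of its image. *)
Lemma Ann_symplectic_leaf f : Ann S f <-> block2 J f = 0.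
Proof.
split=> [fS|f0 _ /memv_imgP[g _ ->]].
  apply: dualv_separates => g; rewrite (gc_block2_skew hJ) fS ?oppr0 //.
  by rewrite memv_img ?memvf.
by rewrite (gc_block2_skew hJ) f0 linear0 oppr0.
Qed.

Lemma symplectic_leaf_block1 v : v \in S -> block1 J v \in S.
Proof.
move=> /memv_imgP[f _ ->]; have [/eqP + _] := gc_block_form hJ f.
by rewrite addr_eq0 => /eqP ->; rewrite memvN memv_img ?memvf.
Qed.

Lemma symplectic_leaf_stable v f : v \in S -> (J (v, f)).1 \in S.
Proof.
by move=> vS; rewrite gcE /= memvD ?symplectic_leaf_block1 ?memv_img ?memvf.
Qed.

(** The induced bivector is injective: if it kills [g], extended to [f] on [V], then [block2 J f],
    which lies in [S], is zero, so [f] annihilates [S] and [g = 0]. *)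
Lemma symplectic_leaf_B_symplectic : B_symplectic_subspace J S.
Proof.
have gcS : gc_subspace J S.
  by apply: (stable_gc_subspace hJ); exact: symplectic_leaf_stable.
split=> //; have [JS hS] := gc_subspace_induced hJ gcS; exists JS; split=> //.
apply: (B_symplectic_of_block2 hS.1); apply: raddf_inj => g.
have [f <-] := dual_restr_onto g.
have := @induced_subE _ _ _ _ hJ JS 0 f hS (mem0v _)
  (symplectic_leaf_stable f (mem0v _)).
rewrite !sub_mapE /gc_restr /= linear0 !gcE_form /= => /(congr1 fst) /= -> J2f.
have {}J2f : block2 J f = 0.
  by rewrite -[LHS](vsprojK (U := S)) ?J2f ?linear0 // memv_img ?memvf.
apply/lfunP => u; rewrite comp_lfunE subv_inclE zero_lfunE.
by have /Ann_symplectic_leaf := J2f; apply; exact: subvsP.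
Qed.

Lemma B_symplectic_sub_leaf T : B_symplectic_subspace J T -> (T <= S)%VS.
Proof.
move=> [_ [JT [hT /B_symplectic_block2_surj JT2]]]; apply/subvP => v vT.
have [g gv] := JT2 (vsproj T v).
have [[v' f] [/= v'T Jv'T e]] := @induced_sub_lift _ _ _ _ hJ JT (0, g) hT.
(* The vector part of the lift lies in [T] and becomes zero there, so it is zero. *)
have := congr1 fst e; rewrite sub_mapE /= => /(congr1 vsval).
rewrite vsprojK // linear0 => v'0; rewrite {}v'0 in e Jv'T *.
rewrite gcE_form sub_mapE => /(congr1 fst) /=; rewrite gv gcE_form /=.
move: Jv'T; rewrite gcE_form /= => J2T /(congr1 vsval).
by rewrite !vsprojK // => ->; rewrite memv_img ?memvf.
Qed.

(** Functionals on [V/S] pull back into [Ann S], the kernel of the bivector, so the induced bivector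
    vanishes. *)
Lemma leaf_quotient_B_complex JQ : @induced_quot R V J S JQ -> B_complex JQ.
Proof.
move=> hQ; apply: (B_complex_of_block2 hQ.1); apply/lfunP => g.
pose f := (g \o quotv_proj S)%VF; have fS : Ann S f by exact: Ann_pullback.
have J2f : block2 J f = 0 by exact/Ann_symplectic_leaf.
have J4f : Ann S (block4 J f).
  apply/Ann_symplectic_leaf; have [/eqP + _] := gc_block_form hJ f.
  by rewrite J2f linear0 add0r => /eqP.
have := @induced_quotE _ _ _ _ hJ JQ (0, f) hQ fS.
rewrite gcE_form J2f => /(_ J4f); rewrite quot_map_pullback quot_mapE //.
by rewrite linear0 gcE_form zero_lfunE => /(congr1 fst).
Qed.

Lemma leaf_stable_Ann : stable_Ann J S.
Proof.
move=> f /Ann_symplectic_leaf J2f; exists (block4 J f); last first.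
  by rewrite gcE_form J2f.
apply/Ann_symplectic_leaf; have [/eqP + _] := gc_block_form hJ f.
by rewrite J2f linear0 add0r => /eqP.
Qed.

Lemma leaf_quotient_complex : exists JQ : 'End(quotv S),
  is_neg_transpose J JQ /\ complex_structure JQ.
Proof.
(* [block4 J] is minus the transpose of [block1 J], so the map sought is the one that [block1 J]
   induces on [V/S]. *)
exists (quotv_proj S \o (block1 J \o quot_section S))%VF; split=> [f q fS|q].
  have [f' f'S Jf] := leaf_stable_Ann fS.
  rewrite Jf /= comp_lfunE quotv_etaE // -{2}[q]quot_sectionK quotv_etaE.
    rewrite comp_lfunE (gc_block1_transpose hJ) opp_lfunE.
    by have := Jf; rewrite gcE_form => /(congr1 snd) /= ->.
  by move=> w wS; rewrite opp_lfunE f'S // oppr0.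
rewrite !(comp_lfunE (quotv_proj S)) !(comp_lfunE (block1 J)).
set v := quot_section S q; set v' := quot_section S _.
apply/eqP; rewrite -[q]quot_sectionK -/v -addr_eq0 -linearD quotv_proj_eq0.
have v'S : v' - block1 J v \in S.
  by rewrite -quotv_proj_eq0 linearB /= quot_sectionK subrr.
(* Modulo [S], the image of [block2], the relation [block1^2 + block2 \o block3 = -1] reads
   [block1^2 = -1]. *)
have [/eqP + _] := gc_block_vec hJ v.
rewrite addrC -subr_eq0 opprK -addrA addr_eq0 => /eqP e.
have -> : block1 J v' + v = block1 J (v' - block1 J v) - block2 J (block3 J v).
  by rewrite e opprK linearB /= subrKA.
by rewrite memvB ?symplectic_leaf_block1 ?memv_img ?memvf.
Qed.

End SymplecticLeaf.

(** * The minimal subspace [C] with [beta]-symplectic quotient *)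

Section ComplexCore.
Variables (R : realType) (V : vectType R) (J : 'End(gcsp V)).
Hypothesis hJ : gc_structure J.

Definition complex_core : {vspace V} := lker (block3 J).
Local Notation C := complex_core.

Lemma complex_coreP v : reflect (block3 J v = 0) (v \in C).
Proof. by rewrite memv_ker; apply: eqP. Qed.

Lemma complex_core_vec v : v \in C -> J (v, 0) = (block1 J v, 0).
Proof. by move=> /complex_coreP J3v; rewrite gcE_vec J3v. Qed.

Lemma complex_core_block1 v : v \in C -> block1 J v \in C.
Proof.
move=> /complex_coreP J3v; apply/complex_coreP.
by have [_] := gc_block_vec hJ v; rewrite J3v linear0 addr0.
Qed.

Lemma complex_core_block11 v : v \in C -> block1 J (block1 J v) = - v.
Proof.
move=> /complex_coreP J3v.
by have [+ _] := gc_block_vec hJ v; rewrite J3v linear0 addr0.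
Qed.

(** By skewness [block3] takes values in [Ann C]; [block4], minus the transpose of [block1],
    preserves [Ann C] because [block1] preserves [C]. *)
Lemma complex_core_Ann x : Ann C x.2 -> Ann C (J x).2.
Proof.
case: x => v f /= fC w wC; rewrite gcE /= add_lfunE (gc_block3_skew hJ).
have /complex_coreP -> := wC; rewrite zero_lfunE oppr0 add0r.
rewrite -[LHS]opprK -(gc_block1_transpose hJ) fC ?oppr0 //.
exact: complex_core_block1.
Qed.

Let Ann0 (T : {vspace V}) : Ann T (0 : dualv V).
Proof. by move=> v _; rewrite zero_lfunE. Qed.

(** The induced 2-form is injective: if it kills the class of [v], then [block3 J v], which descends
    to the quotient, is zero, so [v] lies in [C]. *)
Lemma complex_core_beta_symplectic : beta_symplectic_quotient J C.
Proof.
have gcC : gc_quotient J C.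
  by apply: (stable_gc_quotient hJ); exact: complex_core_Ann.
split=> //; have [JQ hQ] := gc_quotient_induced hJ gcC; exists JQ; split=> //.
apply: (beta_symplectic_of_block3 hQ.1); apply: raddf_inj => q.
rewrite -[q]quot_sectionK; set v := quot_section C q.
have J3C : Ann C (block3 J v).
  by have := @complex_core_Ann (v, 0) (@Ann0 C); rewrite gcE_vec.
have := @induced_quotE _ _ _ _ hJ JQ (v, 0) hQ (@Ann0 C).
rewrite gcE_vec => /(_ J3C); rewrite quot_map_vec gcE_vec quot_mapE //.
move=> /(congr1 snd) /= -> e; apply/eqP; rewrite quotv_proj_eq0.
apply/complex_coreP/lfunP => w.
by rewrite -(quotv_etaE w J3C) e !zero_lfunE.
Qed.

Lemma complex_core_sub_beta_symplectic T :
  beta_symplectic_quotient J T -> (C <= T)%VS.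
Proof.
move=> [_ [JQ [hQ /beta_symplectic_block3_inj i3]]]; apply/subvP => c cC.
have := @induced_quotE _ _ _ _ hJ JQ (c, 0) hQ (@Ann0 T).
rewrite complex_core_vec // => /(_ (@Ann0 T)); rewrite !quot_map_vec gcE_vec.
move=> /(congr1 snd) /= J3c.
by rewrite -quotv_proj_eq0; apply/eqP/i3; rewrite J3c linear0.
Qed.

Lemma complex_core_stable : stable_subspace J C.
Proof.
move=> c cC; exists (block1 J c); first exact: complex_core_block1.
exact: complex_core_vec.
Qed.

Lemma complex_core_graph : exists JC : 'End(subvs_of C),
  [/\ is_restriction J JC, complex_structure JC
    & graph_condition J (complex_gc JC)].
Proof.
exists (linfun (vsproj C) \o (block1 J \o subv_incl C))%VF.
set JC := (X in is_restriction J X).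
have JCE w : vsval (JC w) = block1 J (vsval w).
  rewrite /JC comp_lfunE lfunE /= comp_lfunE subv_inclE vsprojK //.
  by rewrite complex_core_block1 ?subvsP.
split=> [w|w|_ /diagP[w ->]].
- by rewrite JCE complex_core_vec ?subvsP.
- by apply: val_inj; rewrite /= !JCE complex_core_block11 ?subvsP // linearN.
(* The twist changes only the signs of the off-diagonal blocks, which vanish here. *)
have twistE : twist (complex_gc JC) (w, 0) = (JC w, 0).
  have := complex_gcE JC w 0; rewrite gcE_vec linear0 oppr0 => e.
  have /= b1 := congr1 fst e; have /= b3 := congr1 snd e.
  by rewrite blockE /= !opp_lfunE b1 b3 !linear0 !addr0.
rewrite gc_sumE /gc_sum_fun /= !comp_lfun0l complex_core_vec ?subvsP // twistE.
rewrite /= !comp_lfun0l addr0; split; last by move=> x _; rewrite zero_lfunE.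
by apply/diagP; exists (JC w); rewrite JCE.
Qed.

(** On [C] the image [J (c, 0)] has no functional part, so the induced 2-form vanishes. *)
Lemma complex_core_beta_complex JC : @induced_sub R V J C JC -> beta_complex JC.
Proof.
move=> hC; apply: (beta_complex_of_block3 hC.1); apply/lfunP => u.
have uC := subvsP u.
have := @induced_subE _ _ _ _ hJ JC (vsval u) 0 hC uC.
rewrite complex_core_vec // => /(_ (complex_core_block1 uC)).
rewrite !sub_mapE /gc_restr /= comp_lfun0l vsvalK gcE_vec zero_lfunE.
by move=> /(congr1 snd).
Qed.

End ComplexCore.

(** * Uniqueness of the extremal subspaces and assembly *)

(** A maximal element lies below the greatest one, hence equals it. *)
Lemma greatest_unique_maximal (R : realType) (V : vectType R)
    (P : {vspace V} -> Prop) S :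
  P S -> (forall T, P T -> (T <= S)%VS) -> unique (maximal_vspace P) S.
Proof.
move=> PS leS; split=> [|S' [PS' maxS']]; last exact: maxS' _ (leS _ PS').
by split=> // T PT leT; apply/eqP; rewrite eqEsubv leS.
Qed.

Lemma least_unique_minimal (R : realType) (V : vectType R)
    (P : {vspace V} -> Prop) C :
  P C -> (forall T, P T -> (C <= T)%VS) -> unique (minimal_vspace P) C.
Proof.
move=> PC geC; split=> [|C' [PC' minC']]; last exact: minC' _ (geC _ PC').
by split=> // T PT leT; apply/eqP; rewrite eqEsubv leT geC.
Qed.

Theorem theorem3p9 (R : realType) (V : vectType R) (J : 'End(gcsp V))
    (hJ : gc_structure J) :
  (exists S : {vspace V},
    [/\ unique (maximal_vspace (B_symplectic_subspace J)) S,
        gc_quotient J S ->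
          exists JQ : 'End(gcsp (quotv S)),
            induced_quot J JQ /\ B_complex JQ,
        stable_Ann J S
      & exists JQ : 'End(quotv S),
          is_neg_transpose J JQ /\ complex_structure JQ])
  /\
  (exists C : {vspace V},
    [/\ unique (minimal_vspace (beta_symplectic_quotient J)) C,
        stable_subspace J C,
        exists JC : 'End(subvs_of C),
          [/\ is_restriction J JC,
              complex_structure JC
            & graph_condition J (complex_gc JC)]
      & gc_subspace J C ->
          exists JC : 'End(gcsp (subvs_of C)),
            induced_sub J JC /\ beta_complex JC]).
Proof.
split; [exists (symplectic_leaf J) | exists (complex_core J)]; split.
- apply: greatest_unique_maximal; first exact: symplectic_leaf_B_symplectic.
  exact: B_symplectic_sub_leaf.
- move=> /(gc_quotient_induced hJ)[JQ hQ]; exists JQ; split=> //.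
  exact: leaf_quotient_B_complex hQ.
- exact: leaf_stable_Ann.
- exact: leaf_quotient_complex.
- apply: least_unique_minimal; first exact: complex_core_beta_symplectic.
  exact: complex_core_sub_beta_symplectic.
- exact: complex_core_stable.
- exact: complex_core_graph.
- move=> /(gc_subspace_induced hJ)[JC hC]; exists JC; split=> //.
  exact: complex_core_beta_complex hC.
Qed.
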